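(* Let $\boldsymbol{x}_{\rm s},\boldsymbol{x}_{\rm d}\in\mathbb{R}^2$, let $\boldsymbol{w}=\frac{\boldsymbol{x}_{\rm s}+\boldsymbol{x}_{\rm d}}{2}$ and $d=\|\boldsymbol{x}_{\rm s}-\boldsymbol{w}\|=\|\boldsymbol{x}_{\rm d}-\boldsymbol{w}\|$, and let $\widehat{s}(\boldsymbol{x})=\max\{\|\boldsymbol{x}_{\rm s}-\boldsymbol{x}\|,\|\boldsymbol{x}-\boldsymbol{x}_{\rm d}\|\}$. Let $\varphi\subset\mathbb{R}^2$ be a locally finite set with at least two points, let $\boldsymbol{x}_{\rm mid}\in\varphi$ be the point of $\varphi$ closest to $\boldsymbol{w}$ (the relay selected by the mid-point relay selection policy $\mathcal{P}_{\rm mid}$), and let $\boldsymbol{x}_{(2)}\in\varphi$ be the second closest point of $\varphi$ to $\boldsymbol{w}$. If $$\widehat{s}(\boldsymbol{x}_{\rm mid})\le\sqrt{d^2+\|\boldsymbol{x}_{(2)}-\boldsymbol{w}\|^2},$$ then $\mathcal{P}_{\rm mid}$ solves the problem of minimizing $\widehat{s}(\boldsymbol{x})$ over $\boldsymbol{x}\in\varphi$, i.e. $\widehat{s}(\boldsymbol{x}_{\rm mid})=\min_{\boldsymbol{x}\in\varphi}\widehat{s}(\boldsymbol{x})$.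
   Context: $\|\cdot\|$ is the Euclidean norm. A set $\varphi\subset\mathbb{R}^2$ is locally finite if every bounded subset of $\mathbb{R}^2$ contains only finitely many of its points. The points of $\varphi$ are ordered by increasing distance to $\boldsymbol{w}$ (ties broken arbitrarily); $\boldsymbol{x}_{\rm mid}$ is the first and $\boldsymbol{x}_{(2)}$ is the second point in this ordering. *)

(* Defs.v *)
From HB Require Import structures.
From mathcomp Require Import all_boot all_order all_algebra.
From mathcomp Require Import ring lra.
From mathcomp Require Import all_classical all_reals all_analysis.
Set Implicit Arguments.
Unset Strict Implicit.
Unset Printing Implicit Defensive.
Import Order.TTheory GRing.Theory Num.Theory.
Import numFieldNormedType.Exports.
Local Open Scope classical_set_scope.
Local Open Scope ring_scope.

Section Defs.
Variable R : realType.
Local Notation plane := 'rV[R]_2.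
Implicit Types (x w xs xd : plane) (phi A : set plane) (r : rel plane).

(* The library norm [`|x|] on row vectors is the sup norm, hence this one. *)
Definition enorm x : R := Num.sqrt (\sum_(i < 2) x 0 i ^+ 2).

Definition midpoint xs xd : plane := 2^-1 *: (xs + xd).

(* The half-distance is taken from [xs]; by this fact [xd] gives the same. *)
Fact enorm_midpoint xs xd :
  enorm (xs - midpoint xs xd) = enorm (xd - midpoint xs xd).
Proof.
congr Num.sqrt; apply: eq_bigr => i _; rewrite /midpoint !mxE -[LHS]sqrrN.
by congr (_ ^+ 2); rewrite opprB {1 2}[xs 0 i]splitr {1 2}[xd 0 i]splitr; lra.
Qed.

Definition shat xs xd x : R :=
  Num.max (enorm (xs - x)) (enorm (x - xd)).

(* [bounded_set] refers to the sup norm, which has the same bounded sets as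
   [enorm]. *)
Definition locally_finite phi : Prop :=
  forall B : set plane, bounded_set B -> finite_set (phi `&` B).

(* [r] lists the points of [phi] by increasing distance to [w]: a total order
   on [phi] along which the distance is nondecreasing.  How [r] orders points
   at equal distance is unconstrained. *)
Definition distance_order w phi r : Prop :=
  [/\ {in phi, reflexive r}, {in phi &, antisymmetric r},
      {in phi & &, transitive r}, {in phi &, total r} &
      {in phi &, forall x y, r x y -> enorm (x - w) <= enorm (y - w)}].

Definition first_point r phi x : Prop :=
  phi x /\ forall y, phi y -> r x y.

Definition second_point r phi x : Prop :=
  exists2 x1, first_point r phi x1 & first_point r (phi `\ x1) x.

Definition is_minimizer (f : plane -> R) A x : Prop :=
  A x /\ lbound (f @` A) (f x).

End Defs.

(* Main.v *)
(** By Apollonius' theorem, the mean of the squared distances from [x] to [xs]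
    and [xd] is [d^2 + |x - w|^2], so [shat x >= sqrt (d^2 + |x - w|^2)].  Any
    point other than [xmid] is at least as far from [w] as [x2] is, hence its
    [shat] is at least [sqrt (d^2 + |x2 - w|^2) >= shat xmid]. *)
Require Import Defs.
From HB Require Import structures.
From mathcomp Require Import all_boot all_order all_algebra.
From mathcomp Require Import ring lra.
From mathcomp Require Import all_classical all_reals all_analysis.
Import Order.TTheory GRing.Theory Num.Theory.
Import numFieldNormedType.Exports.
Local Open Scope classical_set_scope.
Local Open Scope ring_scope.

Lemma enorm_ge0 (R : realType) (x : 'rV[R]_2) : 0 <= enorm x.
Proof. exact: sqrtr_ge0. Qed.

Lemma sqr_enorm (R : realType) (x : 'rV[R]_2) :
  enorm x ^+ 2 = \sum_(i < 2) x 0 i ^+ 2.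
Proof. by rewrite sqr_sqrtr// sumr_ge0// => i _; exact: sqr_ge0. Qed.

(** Squared norms are sums over coordinates, so the claim reduces to a polynomial identity in each
    coordinate. *)
Lemma apollonius (R : realType) (xs xd x : 'rV[R]_2) (w := midpoint xs xd) :
  enorm (xs - x) ^+ 2 + enorm (x - xd) ^+ 2 =
  2 * (enorm (xs - w) ^+ 2 + enorm (x - w) ^+ 2).
Proof.
rewrite !sqr_enorm -!big_split mulr_sumr; apply: eq_bigr => i _.
by rewrite /= /w /midpoint !mxE; field.
Qed.

(** A maximum of two nonnegative numbers is at least their quadratic mean, which [apollonius]
    evaluates. *)
Lemma shat_ge (R : realType) (xs xd x : 'rV[R]_2) (w := midpoint xs xd) :
  Num.sqrt (enorm (xs - w) ^+ 2 + enorm (x - w) ^+ 2) <= shat xs xd x.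
Proof.
have s0 : 0 <= shat xs xd x by rewrite le_max enorm_ge0.
(* Writing [shat] as the root of its square reduces the claim to the radicands. *)
rewrite -(ger0_norm s0) -sqrtr_sqr ler_wsqrtr//.
have -> : enorm (xs - w) ^+ 2 + enorm (x - w) ^+ 2 =
    (enorm (xs - x) ^+ 2 + enorm (x - xd) ^+ 2) / 2.
  by rewrite apollonius mulrC mulKf.
have : enorm (xs - x) ^+ 2 <= shat xs xd x ^+ 2.
  by rewrite ler_sqr ?nnegrE ?enorm_ge0// le_max lexx.
have : enorm (x - xd) ^+ 2 <= shat xs xd x ^+ 2.
  by rewrite ler_sqr ?nnegrE ?enorm_ge0// le_max lexx orbT.
lra.
Qed.

(** Antisymmetry of [r] decides even between points equally close to [w]. *)
Lemma first_point_unique (R : realType) (w : 'rV[R]_2) (phi : set 'rV[R]_2)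
    (r : rel 'rV[R]_2) (x y : 'rV[R]_2) :
  distance_order w phi r -> first_point r phi x -> first_point r phi y ->
  x = y.
Proof.
move=> [_ anti _ _ _] [px rx] [py ry].
by apply: anti; rewrite ?inE// rx// ry.
Qed.

Theorem theorem1 (R : realType) (xs xd : 'rV[R]_2) (phi : set 'rV[R]_2)
    (r : rel 'rV[R]_2) (xmid x2 : 'rV[R]_2) :
  let w := midpoint xs xd in
  let d := enorm (xs - w) in
  locally_finite phi ->
  (exists x y, [/\ phi x, phi y & x <> y]) ->
  distance_order w phi r ->
  first_point r phi xmid ->
  second_point r phi x2 ->
  shat xs xd xmid <= Num.sqrt (d ^+ 2 + enorm (x2 - w) ^+ 2) ->
  is_minimizer (shat xs xd) phi xmid.
Proof.
move=> w d _ _ ordr fmid [x1 fx1 [[px2 _] rx2]] hmid.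
split=> [|_ [y py <-]]; first exact: fmid.1.
have [->//|/eqP ymid] := eqVneq y xmid.
have rx2y : r x2 y.
  apply: rx2; split=> //.
  (* The point [x1] removed in [second_point] is [xmid], so [y] survives the removal. *)
  by rewrite -(first_point_unique _ _ _ _ _ _ ordr fmid fx1).
have [_ _ _ _ mono] := ordr.
(* It remains to compare the two roots, hence the distances of [x2] and [y] to [w]. *)
apply: (le_trans hmid); apply: le_trans (shat_ge _ xs xd y).
rewrite ler_wsqrtr// lerD2l ler_sqr ?nnegrE ?enorm_ge0//.
by apply: mono; rewrite ?inE.
Qed.
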